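(* Let $M,k\ge1$, let $I_M=\{1,\dots,M\}$, and let $\mathcal K$ be a linear operator on the space $L(I_M,\mathbb C^k)$ of functions $I_M\to\mathbb C^k$, with block matrix $\mathbf K\in\mathbb C^{kM\times kM}$ having $k\times k$ blocks $\mathbf K(n,m)$, $n,m\in I_M$. Let $$\boldsymbol\Phi_{\mathbf m,\mathbf j}=\phi_{m_1,j_1}\wedge\dots\wedge\phi_{m_n,j_n}\in\wedge^n(L(I_M,\mathbb C^k)),$$ and let $\mathcal M_M^{(n)}=\{\mathbf m=(m_1,\dots,m_n):1\le m_\alpha\le M\ \forall\alpha\}$ and $J_k^{(n)}=\{\mathbf j=(j_1,\dots,j_n):1\le j_\alpha\le k\ \forall\alpha\}$. Then for each $n$, $$\operatorname{Tr}(\wedge^n\mathcal K)=\frac1{n!}\sum_{\mathbf j\in J_k^{(n)}}\sum_{\mathbf m\in\mathcal M_M^{(n)}}\langle\boldsymbol\Phi_{\mathbf m,\mathbf j},(\wedge^n\mathcal K)\boldsymbol\Phi_{\mathbf m,\mathbf j}\rangle_{\wedge^n(L(I_M,\mathbb C^k))},$$ and for all $z\in\mathbb C$ the regular Fredholm determinant ${\det}_1(\mathcal I+z\mathcal K)$ is given by $$\det(\mathbf I+z\mathbf K)=\sum_{n=0}^\infty\frac{z^n}{n!}\sum_{\mathbf j\in J_k^{(n)}}\sum_{\mathbf m\in\mathcal M_M^{(n)}}\det\left([\mathbf K(m_\alpha,m_\beta)]_{j_\alpha j_\beta}\right)_{\alpha,\beta=1}^n .$$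
   Context: $L(I_M,\mathbb C^k)$ has inner product $\langle\phi,\psi\rangle=\sum_{m=1}^M\langle\phi(m),\psi(m)\rangle_{\mathbb C^k}$ (conjugate linear in the first slot). It has the orthonormal basis $\phi_{m,j}(\ell):=\delta_{m\ell}\mathbf e_j$, $1\le m\le M$, $1\le j\le k$, where $\mathbf e_j$ is the standard basis of $\mathbb C^k$. The $k\times k$ matrix $\mathbf K(n,m)$ has entries $[\mathbf K(n,m)]_{i,j}=\langle\phi_{n,i},\mathcal K\phi_{m,j}\rangle$, so that $(\mathcal K\phi)(n)=\sum_{m=1}^M\mathbf K(n,m)\phi(m)$; $\mathbf K$ is the $M\times M$ block matrix with $(n,m)$ block $\mathbf K(n,m)$. For a Hilbert space $\mathsf H$, $\psi_1\wedge\dots\wedge\psi_n=\frac1{\sqrt{n!}}\sum_\pi(-1)^\pi\psi_{\pi(1)}\otimes\dots\otimes\psi_{\pi(n)}\in\bigotimes^n\mathsf H$ (sum over permutations of $\{1,\dots,n\}$); $\wedge^n\mathsf H$ is the closed span of these, with the inner product inherited from $\bigotimes^n\mathsf H$ and $\wedge^0\mathsf H=\mathbb C$; and $\wedge^n\mathcal K$ is the restriction of $\mathcal K\otimes\dots\otimes\mathcal K$ to $\wedge^n\mathsf H$. ${\det}_1(\mathcal I+z\mathcal K):=\sum_{n\ge0}z^n\operatorname{Tr}(\wedge^n\mathcal K)$. The $n=0$ term of the series equals $1$. *)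

(* Defs.v *)
From HB Require Import structures.
From mathcomp Require Import all_boot all_order all_algebra all_fingroup.
From mathcomp Require Import complex.
From mathcomp Require Import boolp classical_sets reals topology normedtype.
From mathcomp Require Import sequences.

Set Implicit Arguments.
Unset Strict Implicit.
Unset Printing Implicit Defensive.

Import Order.TTheory GRing.Theory Num.Theory.
Import numFieldNormedType.Exports.

Local Open Scope ring_scope.

Section LinearAlgebra.
Variables (F : fieldType) (V : vectType F).

Lemma setspan_ex (A : V -> Prop) : exists U : {vspace V},
  (forall v, A v -> v \in U) /\
  (forall W : {vspace V}, (forall v, A v -> v \in W) -> (U <= W)%VS).
Proof.
pose Q (U : {vspace V}) := forall W : {vspace V},
  (forall v, A v -> v \in W) -> (U <= W)%VS.
suff H d (U : {vspace V}) : Q U -> (\dim {:V} - \dim U <= d)%N ->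
    exists U' : {vspace V}, (forall v, A v -> v \in U') /\ Q U'.
  by apply: (H _ 0%VS _ (leqnn _)) => W _; exact: sub0v.
elim: d U => [|d IHd] U QU.
  rewrite leqn0 subn_eq0 => dU; exists U; split=> // v _.
  suff /eqP -> : U == fullv by exact: memvf.
  by rewrite eqEdim subvf dU.
move=> dU; have [AU|] := pselect (forall v, A v -> v \in U).
  by exists U; split.
move=> /existsNP[v /not_implyP[Av /negP vU]].
apply: (IHd (U + <[v]>)%VS).
  by move=> W AW; rewrite subv_add QU// -memvE AW.
have dlt : (\dim U < \dim (U + <[v]>))%N.
  rewrite ltn_neqAle dimvS ?addvSl// andbT; apply/negP => /eqP dE.
  have : U == (U + <[v]>)%VS by rewrite eqEdim addvSl -dE leqnn.
  move=> /eqP UE; move: vU; rewrite UE => /negP; apply.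
  exact/(subvP (addvSr _ _))/memv_line.
have d2 : (\dim (U + <[v]>) <= \dim {:V})%N by exact/dimvS/subvf.
by rewrite -ltnS; apply: leq_trans dU; rewrite ltn_sub2l// (leq_trans dlt).
Qed.

(* The linear span of an arbitrary, possibly infinite, family of vectors. *)
Definition setspan (A : V -> Prop) : {vspace V} := projT1 (cid (setspan_ex A)).

Lemma mem_setspan (A : V -> Prop) v : A v -> v \in setspan A.
Proof. by rewrite /setspan; case: cid => U [+ _] /=; apply. Qed.

Lemma setspan_sub (A : V -> Prop) (W : {vspace V}) :
  (forall v, A v -> v \in W) -> (setspan A <= W)%VS.
Proof. by rewrite /setspan; case: cid => U [_ +] /=; apply. Qed.

Definition lftrace (f : 'End(V)) : F :=
  \tr (passmx.mxof (vbasis {:V}) (vbasis {:V}) f).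

(* The restriction of f to U, as an endomorphism of U; it agrees with f on U
   as soon as U is stable under f. *)
Definition restr_op (U : {vspace V}) (f : 'End(V)) : 'End(subvs_of U) :=
  linfun (vsproj U \o f \o vsval).

Lemma restr_opE (U : {vspace V}) (f : 'End(V)) (u : subvs_of U) :
  (f @: U <= U)%VS -> vsval (restr_op U f u) = f (vsval u).
Proof.
move=> fU; rewrite lfunE /= vsprojK//.
by apply: (subvP fU); rewrite memv_img// subvsP.
Qed.

Lemma lftraceE n (b : n.-tuple V) (f : 'End(V)) : basis_of fullv b ->
  lftrace f = \sum_(i < n) coord b i (f b`_i).
Proof.
move=> bb; rewrite /lftrace /mxtrace.
set e := vbasis _; have be : basis_of fullv e by exact: vbasisP.
have -> : \sum_i passmx.mxof e e f i i = \sum_i coord e i (f e`_i).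
  by apply: eq_bigr => i _; rewrite !mxE /= passmx.vecof_delta.
have Eb v : v = \sum_j coord b j v *: b`_j by exact: coord_basis bb (memvf v).
have Ee v : v = \sum_j coord e j v *: e`_j by exact: coord_basis be (memvf v).
transitivity (\sum_(i < \dim {:V}) \sum_(j < n) coord b j e`_i * coord e i (f b`_j)).
  apply: eq_bigr => i _; rewrite [in LHS](Eb e`_i) !linear_sum.
  by apply: eq_bigr => j _; rewrite !linearZ.
rewrite exchange_big; apply: eq_bigr => j _ /=.
rewrite [in RHS](Ee (f b`_j)) linear_sum; apply: eq_bigr => i _.
by rewrite linearZ /= mulrC.
Qed.

End LinearAlgebra.

Section Wedge.
Variables (R : realType) (M k : nat).
Notation C := R[i].

Definition LIM := {ffun 'I_M -> 'cV[C]_k}.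

Definition Lip (phi psi : LIM) : C :=
  \sum_(m < M) \sum_(j < k) (phi m j 0)^* * psi m j 0.

Definition Lbasis (m : 'I_M) (j : 'I_k) : LIM :=
  [ffun l => if l == m then delta_mx j 0 else 0].

Lemma Lip_basis m j (psi : LIM) : Lip (Lbasis m j) psi = psi m j 0.
Proof.
rewrite /Lip (bigD1 m)//= (bigD1 j)//= ffunE eqxx mxE !eqxx rmorph1 mul1r.
rewrite !big1 ?addr0// => [m' mm'|i ij].
  by rewrite big1// => i _; rewrite ffunE (negbTE mm') mxE rmorph0 mul0r.
by rewrite mxE (negbTE ij) rmorph0 mul0r.
Qed.

Lemma Lbasis_sum (psi : LIM) :
  psi = \sum_(p : 'I_M * 'I_k) psi p.1 p.2 0 *: Lbasis p.1 p.2.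
Proof.
rewrite -(pair_bigA _ (fun m j => psi m j 0 *: Lbasis m j)) /=.
apply/ffunP => l; rewrite sum_ffunE (bigD1 l)//= sum_ffunE.
rewrite [X in _ + X]big1 ?addr0 => [|m ml].
  apply/colP => i; rewrite summxE (bigD1 i)//= !ffunE eqxx !mxE !eqxx mulr1.
  rewrite big1 ?addr0// => j ji; rewrite !ffunE eqxx !mxE.
  by rewrite [i == j]eq_sym (negbTE ji) mulr0.
rewrite sum_ffunE big1// => j _; rewrite !ffunE.
by rewrite eq_sym (negbTE ml) scaler0.
Qed.

Definition kblock (K : 'End(LIM)) (n m : 'I_M) : 'M[C]_k :=
  \matrix_(i, j) Lip (Lbasis n i) (K (Lbasis m j)).

Definition Kmx (K : 'End(LIM)) := \mxblock_(n < M, m < M) kblock K n m.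

Lemma kblockE (K : 'End(LIM)) (phi : LIM) n :
  K phi n = \sum_(m < M) kblock K n m *m phi m.
Proof.
apply/colP => i; rewrite {1}[phi]Lbasis_sum linear_sum sum_ffunE !summxE.
rewrite -(pair_bigA _ (fun m j => K (phi m j 0 *: Lbasis m j) n i 0)) /=.
apply: eq_bigr => m _; rewrite mxE; apply: eq_bigr => j _.
by rewrite linearZ !ffunE !mxE Lip_basis mulrC.
Qed.

(* The n-th tensor power of L(I_M, C^k), in the orthonormal basis of the
   phi_{m_1,j_1} (x) ... (x) phi_{m_n,j_n}: the tensor t has coordinate
   t ((m_1,j_1), ..., (m_n,j_n)) on this vector.  For n = 0 it is C. *)
Definition tensor (n : nat) := {ffun {ffun 'I_n -> 'I_M * 'I_k} -> C^o}.

Definition tip n (s t : tensor n) : C := \sum_f (s f)^* * t f.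

Definition ptensor n (psi : 'I_n -> LIM) : tensor n :=
  [ffun f : {ffun 'I_n -> 'I_M * 'I_k} => \prod_(a < n) psi a (f a).1 (f a).2 0].

Lemma tip_ptensor n (psi chi : 'I_n -> LIM) :
  tip (ptensor psi) (ptensor chi) = \prod_(a < n) Lip (psi a) (chi a).
Proof.
rewrite /tip /Lip.
under [RHS]eq_bigr => a _ do
  rewrite (pair_bigA _ (fun m j => (psi a m j 0)^* * chi a m j 0)) /=.
rewrite bigA_distr_bigA; apply: eq_bigr => f _.
by rewrite !ffunE rmorph_prod -big_split.
Qed.

(* The linear extension of the map sending each basis tensor
   phi_{m_1,j_1} (x) ... (x) phi_{m_n,j_n} to the tensor product of the
   K phi_{m_a,j_a}; see tensor_op_ptensor. *)
Definition tensor_fun (K : 'End(LIM)) n (t : tensor n) : tensor n :=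
  \sum_f t f *: ptensor (fun a => K (Lbasis (f a).1 (f a).2)).

Lemma tensor_fun_is_linear K n : linear (@tensor_fun K n).
Proof.
move=> c s t; rewrite /tensor_fun scaler_sumr -big_split.
by apply: eq_bigr => f _; rewrite !ffunE scalerDl scalerA.
Qed.

HB.instance Definition _ K n := GRing.isLinear.Build C (tensor n) (tensor n) _
  (@tensor_fun K n) (@tensor_fun_is_linear K n).

Definition tensor_op (K : 'End(LIM)) n : 'End(tensor n) :=
  linfun (@tensor_fun K n).

Lemma tensor_op_ptensor K n (psi : 'I_n -> LIM) :
  tensor_op K n (ptensor psi) = ptensor (fun a => K (psi a)).
Proof.
rewrite lfunE /= /tensor_fun; apply/ffunP => g; rewrite sum_ffunE ffunE.
under [RHS]eq_bigr => a _ do rewrite [psi a]Lbasis_sum linear_sum sum_ffunE summxE.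
rewrite bigA_distr_bigA; apply: eq_bigr => f _; rewrite !ffunE.
rewrite /GRing.scale/= -big_split; apply: eq_bigr => a _.
by rewrite linearZ ffunE mxE.
Qed.

Definition wedge n (psi : 'I_n -> LIM) : tensor n :=
  (sqrtC n`!%:R)^-1 *: \sum_(s : 'S_n) (-1) ^+ s *: ptensor (psi \o s).

Definition wedge_space n : {vspace tensor n} :=
  setspan (fun t => exists psi : 'I_n -> LIM, t = wedge psi).

Lemma wedge_mem n (psi : 'I_n -> LIM) : wedge psi \in wedge_space n.
Proof. by apply: mem_setspan; exists psi. Qed.

Lemma tensor_op_wedge K n (psi : 'I_n -> LIM) :
  tensor_op K n (wedge psi) = wedge (fun a => K (psi a)).
Proof.
rewrite /wedge linearZ linear_sum; congr (_ *: _); apply: eq_bigr => s _.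
by rewrite linearZ /= tensor_op_ptensor.
Qed.

Lemma tensor_op_wedge_space K n :
  (tensor_op K n @: wedge_space n <= wedge_space n)%VS.
Proof.
have /subvP WT : (wedge_space n <= tensor_op K n @^-1: wedge_space n)%VS.
  apply: setspan_sub => _ [psi ->].
  by rewrite -memv_preim tensor_op_wedge wedge_mem.
by apply/subvP => _ /memv_imgP[u /WT + ->]; rewrite -memv_preim.
Qed.

Definition wedge_pow n := subvs_of (wedge_space n).

Definition wip n (u v : wedge_pow n) : C := tip (vsval u) (vsval v).

Definition wedge_op (K : 'End(LIM)) n : 'End(wedge_pow n) :=
  restr_op (wedge_space n) (tensor_op K n).

Lemma wedge_opE K n (u : wedge_pow n) :
  vsval (wedge_op K n u) = tensor_op K n (vsval u).
Proof. exact/restr_opE/tensor_op_wedge_space. Qed.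

Definition Phi n (m : {ffun 'I_n -> 'I_M}) (j : {ffun 'I_n -> 'I_k}) :
  wedge_pow n := Subvs (wedge_mem (fun a => Lbasis (m a) (j a))).

(* The codomain R[i]^o is what carries the topology of the modulus. *)
Definition det1_term (K : 'End(LIM)) (z : C) (n : nat) : C^o :=
  z ^+ n * lftrace (wedge_op K n).

Definition fredholm_det1 (K : 'End(LIM)) (z : C) : C :=
  limn (series (det1_term K z)).

End Wedge.

(* Main.v *)
(* The trace on the n-th exterior power is computed in the overcomplete family
   of the wedges of basis vectors, indexed by all n-tuples of basis indices: an
   alternating tensor t is the sum over f of t f / sqrt n! times the wedge of f,
   so that the trace is 1/n! times the sum of the minors det (K (f a) (f b)).
   On the other side, det (1 + z K) expands by multilinearity of the rows into
   the sum over subsets S of z^|S| times the determinant of the matrix with the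
   rows of K on S and those of the identity elsewhere.  By Sylvester's identity
   det (1 + U V) = det (1 + V U), this determinant is the minor along any
   injective enumeration f of S, and S has |S|! enumerations, while the minors
   along non-injective f vanish.  In particular both series are finite sums. *)

From HB Require Import structures.
Require Import Defs.
From mathcomp Require Import all_boot all_order all_algebra all_fingroup.
From mathcomp Require Import complex.
From mathcomp Require Import boolp classical_sets reals topology normedtype.
From mathcomp Require Import sequences.

Set Implicit Arguments.
Unset Strict Implicit.
Unset Printing Implicit Defensive.

Import Order.TTheory GRing.Theory Num.Theory.
Import numFieldNormedType.Exports.
Local Open Scope ring_scope.

(** * Determinant identities and principal minors *)

Lemma det_1DmulmxC (R : comNzRingType) m n (U : 'M[R]_(m, n)) (V : 'M_(n, m)) :
  \det (1%:M + U *m V) = \det (1%:M + V *m U).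
Proof.
(* [L] is unit triangular, and [X] factors through it on either side, each time with a block
   triangular cofactor that carries one of the two determinants. *)
pose L : 'M_(m + n) := block_mx 1%:M 0 V 1%:M.
pose X : 'M_(m + n) := block_mx 1%:M (- U) V 1%:M.
have E1 : block_mx (1%:M + U *m V) (- U) 0 1%:M *m L = X.
  by rewrite mulmx_block !(mulmx0, mul0mx, mulmx1, mul1mx, add0r) mulNmx addrK.
have E2 : L *m block_mx 1%:M (- U) 0 (1%:M + V *m U) = X.
  by rewrite mulmx_block !(mulmx0, mul0mx, mulmx1, mul1mx, addr0, add0r) mulmxN
             addrC addrK.
move: (congr1 determinant E1); rewrite -E2 !det_mulmx det_lblock !det_ublock.
by rewrite !det1 !mulr1 !mul1r.
Qed.

Section PrincipalMinors.
Variables (R : comNzRingType) (N : nat) (A : 'M[R]_N).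

Let rows_in (S : {set 'I_N}) : 'M[R]_N :=
  \matrix_(i, j) if i \in S then A i j else (i == j)%:R.

Lemma det_1D_subsets (z : R) :
  \det (1%:M + z *: A) = \sum_(S : {set 'I_N}) z ^+ #|S| * \det (rows_in S).
Proof.
rewrite /determinant.
(* After the swap, the set [S] produced by [bigA_distr] consists of the rows from which [z *: A] is
   taken. *)
under eq_bigr => s _ do under eq_bigr => i _ do rewrite !mxE addrC.
under eq_bigr => s _ do rewrite bigA_distr mulr_sumr.
rewrite exchange_big; apply: eq_bigr => S _ /=; rewrite mulr_sumr.
apply: eq_bigr => s _; rewrite mulrCA; congr (_ * _).
rewrite -prodr_const [in RHS]big_mkcond -big_split /=; apply: eq_bigr => i _.
by rewrite !mxE; case: (i \in S); rewrite ?mul1r.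
Qed.

Lemma det_rows_in n (f : 'I_n -> 'I_N) : injective f ->
  \det (rows_in [set f a | a in 'I_n]) = \det (\matrix_(a, b) A (f a) (f b)).
Proof.
(* [E] selects the rows along [f]; injectivity of [f] makes its own rows orthonormal. *)
move=> fI; pose E : 'M[R]_(n, N) := \matrix_(a, i) (f a == i)%:R.
have Esum p (B : 'M_(N, p)) a j : (E *m B) a j = B (f a) j.
  rewrite mxE (bigD1 (f a))//= mxE eqxx mul1r big1 ?addr0// => i.
  by rewrite mxE eq_sym => /negbTE ->; rewrite mul0r.
have EE : E *m E^T = 1%:M.
  by apply/matrixP => a b; rewrite Esum !mxE (inj_eq fI) eq_sym.
(* Sylvester's identity turns this into det (1 + (E A - E) E^T) = det (E A E^T). *)
have -> : rows_in [set f a | a in 'I_n] = 1%:M + E^T *m (E *m A - E).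
  have ET i j a : E^T i a * (E *m A - E) a j =
      (f a == i)%:R * (A (f a) j - (f a == j)%:R).
    by congr (_ * _); rewrite !mxE//; congr (_ - _); rewrite -Esum mxE.
  apply/matrixP => i j; rewrite !mxE.
  case: imsetP => [[a _ ->]|iE].
    rewrite (bigD1 a)//= ET eqxx mul1r big1 ?addr0 => [|b ba].
      by rewrite addrC subrK.
    by rewrite ET (inj_eq fI) (negbTE ba) mul0r.
  rewrite big1 ?addr0// => a _; rewrite ET.
  case: eqP => [fai|]; last by rewrite mul0r.
  by case: iE; exists a.
rewrite det_1DmulmxC mulmxBl EE addrC subrK; congr (\det _).
apply/matrixP => a b; rewrite -mulmxA Esum !mxE (bigD1 (f b))//= !mxE eqxx mulr1.
rewrite big1 ?addr0// => i; rewrite !mxE eq_sym => /negbTE ->.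
by rewrite mulr0.
Qed.

Lemma det_index_noninj n (f : 'I_n -> 'I_N) : ~~ injectiveb f ->
  \det (\matrix_(a, b) A (f a) (f b)) = 0.
Proof.
case/injectivePn => a [b ab fab].
by apply: (determinant_alternate ab) => c; rewrite !mxE fab.
Qed.

Lemma sum_det_index n :
  \sum_(f : {ffun 'I_n -> 'I_N}) \det (\matrix_(a, b) A (f a) (f b)) =
  n`!%:R * \sum_(S : {set 'I_N} | #|S| == n) \det (rows_in S).
Proof.
rewrite (bigID (fun f : {ffun 'I_n -> 'I_N} => injectiveb f)) /= addrC.
rewrite big1 ?add0r => [|f /det_index_noninj//].
rewrite (partition_big (fun f : {ffun 'I_n -> 'I_N} => [set f a | a in 'I_n])
  (fun S : {set 'I_N} => #|S| == n)) /=; last first.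
  by move=> f /injectiveP fI; rewrite card_imset ?card_ord.
rewrite mulr_sumr; apply: eq_bigr => S /eqP Sn.
transitivity (\sum_(f : {ffun 'I_n -> 'I_N} |
    injectiveb f && (f \in ffun_on (mem S))) \det (rows_in S)).
  apply: eq_big => [f|f /andP[/injectiveP fI /eqP <-]]; last first.
    by rewrite det_rows_in.
  apply: andb_id2l => /injectiveP fI; apply/eqP/ffun_onP => [<- a|fS].
    exact: imset_f.
  (* An injective [f] with values in [S] fills [S], since both have [n] elements. *)
  apply/eqP; rewrite eqEcard card_imset// card_ord Sn leqnn andbT.
  by apply/fintype.subsetP => _ /imsetP[a _ ->]; exact: fS.
rewrite sumr_const mulr_natl; congr (_ *+ _).
(* The count of injections is the falling factorial of [n] of length [n], that is n!. *)
have := card_inj_ffuns_on 'I_n (mem S); rewrite Sn card_ord ffactnn => <-.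
by apply: eq_card => f; rewrite !inE andbC.
Qed.

End PrincipalMinors.

(** Subsets of the index set have sizes 0 to [N], so a partial sum going past [N] meets each of
    them; the n! of [sum_det_index] cancels the division. *)
Lemma det_1D_sum_index (F : numFieldType) N (A : 'M[F]_N) (z : F) n : (N < n)%N ->
  \sum_(i < n) z ^+ i / i`!%:R *
     \sum_(f : {ffun 'I_i -> 'I_N}) \det (\matrix_(a, b) A (f a) (f b)) =
  \det (1%:M + z *: A).
Proof.
move=> Nn; rewrite det_1D_subsets.
have Sn (S : {set 'I_N}) : (#|S| < n)%N.
  by apply: leq_ltn_trans Nn; rewrite -[X in (_ <= X)%N]card_ord max_card.
rewrite (partition_big (fun S : {set 'I_N} => Ordinal (Sn S)) predT)//=.
apply: eq_bigr => i _; rewrite sum_det_index mulrA divfK ?mulr_sumr; last first.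
  by rewrite pnatr_eq0 -lt0n fact_gt0.
by apply: eq_big => [S|S /eqP <-//]; rewrite -val_eqE.
Qed.

(* The b i need not be linearly independent, nor the c i dual to them. *)
Lemma lftrace_frame (F : fieldType) (V : vectType F) (I : finType)
    (b : I -> V) (c : I -> {scalar V}) (f : 'End(V)) :
  (forall v, v = \sum_i c i v *: b i) -> lftrace f = \sum_i c i (f (b i)).
Proof.
move=> bE; rewrite (lftraceE _ (vbasisP _)); set e := vbasis _.
under eq_bigr => l _ do rewrite [X in f X](bE e`_l) !linear_sum.
rewrite exchange_big; apply: eq_bigr => i _ /=.
rewrite [in RHS](coord_basis (vbasisP _) (memvf (f (b i)))) linear_sum.
by apply: eq_bigr => l _; rewrite !linearZ /= mulrC.
Qed.

(** * Alternating tensors and wedges of basis vectors *)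

Section WedgeTrace.
Variables (R : realType) (M k n : nat).
Notation C := R[i].
Notation idx := {ffun 'I_n -> 'I_M * 'I_k}.
Notation root := (sqrtC n`!%:R : C).

Let fact_neq0 : n`!%:R != 0 :> C.
Proof. by rewrite pnatr_eq0 -lt0n fact_gt0. Qed.

Let root_neq0 : root != 0.
Proof. by rewrite sqrtC_eq0. Qed.

Definition basis_wedge (f : idx) : tensor R M k n :=
  wedge (fun a => Lbasis R (f a).1 (f a).2).

(** This is the Leibniz formula with tensor slots as rows and vectors as columns, so permuting [f]
    permutes rows. *)
Lemma wedgeE (psi : 'I_n -> LIM R M k) (f : idx) :
  wedge psi f = root^-1 * \det (\matrix_(a, b) psi b (f a).1 (f a).2 0) :> C.
Proof.
rewrite ffunE sum_ffunE; congr (_ * _); apply: eq_bigr => s _.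
rewrite !ffunE; congr (_ * _).
by apply: eq_bigr => a _; rewrite mxE.
Qed.

Lemma wedge_perm (psi : 'I_n -> LIM R M k) (f : idx) (s : 'S_n) :
  wedge psi [ffun a => f (s a)] = (-1) ^+ s * wedge psi f :> C.
Proof.
rewrite !wedgeE mulrCA; congr (_ * _); rewrite -det_perm -det_mulmx -row_permE.
by congr (\det _); apply/matrixP => a b; rewrite !mxE ffunE.
Qed.

Lemma basis_wedgeE (f g : idx) :
  basis_wedge f g =
  root^-1 * \sum_(s : 'S_n) (-1) ^+ s * (g == [ffun a => f (s a)])%:R :> C.
Proof.
rewrite ffunE sum_ffunE; congr (_ * _); apply: eq_bigr => s _.
rewrite !ffunE; congr (_ * _).
have E a : Lbasis R (f (s a)).1 (f (s a)).2 (g a).1 (g a).2 0 =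
           (g a == f (s a))%:R.
  case: (g a) (f (s a)) => [m j] [m' j'] /=; rewrite ffunE xpair_eqE.
  by case: (m == m'); rewrite !mxE ?andbT.
under eq_bigr => a _ do rewrite /= E.
case: eqP => [->|gf]; first by rewrite big1// => a _; rewrite ffunE eqxx.
have [a /negbTE ga] : exists a, g a != f (s a).
  apply/existsP; rewrite -negb_forall; apply/forallP => gE; apply: gf.
  by apply/ffunP => a; rewrite ffunE; apply/eqP.
by rewrite (bigD1 a)//= ga mul0r.
Qed.

(** The coordinates are a real factor times a sum of signs; this removes the conjugation in
    [tip]. *)
Lemma basis_wedge_conj (f g : idx) : (basis_wedge f g)^* = basis_wedge f g.
Proof.
apply/CrealP; rewrite basis_wedgeE rpredM//.
  by rewrite rpredV ger0_real// sqrtC_ge0 ler0n.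
by apply: rpred_sum => s _; rewrite rpredM ?rpredX ?rpredN ?rpred1 ?rpred_nat.
Qed.

Let sum_signs (x : C) (F : 'S_n -> C) :
  (forall s : 'S_n, F s = (-1) ^+ s * x) -> \sum_(s : 'S_n) (-1) ^+ s * F s = n`!%:R * x.
Proof.
move=> FE; under eq_bigr => s _ do rewrite FE mulrA -expr2 sqrr_sign mul1r.
rewrite sumr_const mulr_natl; congr (_ *+ _).
by rewrite -[RHS]card_Sn; apply: eq_card.
Qed.

Definition alternating (t : tensor R M k n) := forall (f : idx) (s : 'S_n),
  t [ffun a => f (s a)] = (-1) ^+ s * t f :> C.

(** All n! permutations contribute the same [t f], and n! divided by [root] is [root]. *)
Lemma tip_basis_wedge (f : idx) (t : tensor R M k n) : alternating t ->
  tip (basis_wedge f) t = root * t f :> C.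
Proof.
move=> tA; transitivity (root^-1 * \sum_(s : 'S_n)
    (-1) ^+ s * t [ffun a => f (s a)] : C).
  rewrite /tip; under eq_bigr => g _.
    rewrite basis_wedge_conj basis_wedgeE -mulrA mulr_suml.
    under eq_bigr => s _ do rewrite -mulrA.
    over.
  rewrite -mulr_sumr exchange_big; congr (_ * _); apply: eq_bigr => s _ /=.
  rewrite -mulr_sumr; congr (_ * _); rewrite (bigD1 [ffun a => f (s a)])//=.
  by rewrite eqxx mul1r big1 ?addr0// => g /negbTE ->; rewrite mul0r.
rewrite (sum_signs (tA f)) mulrA; congr (_ * _).
by rewrite -[X in _ * X]sqrtCK expr2 mulKf.
Qed.

Lemma tensorZE (x : C) (t : tensor R M k n) (f : idx) :
  (x *: t) f = x * t f :> C.
Proof. by rewrite ffunE. Qed.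

Lemma alternating_sum (t : tensor R M k n) : alternating t ->
  t = \sum_f (root^-1 * t f) *: basis_wedge f.
Proof.
move=> tA; apply/ffunP => g; rewrite sum_ffunE.
(* For each [s], only the tuple [f] obtained from [g] by the inverse of [s] contributes at [g]; the
   two factors [root^-1] make 1/n!. *)
transitivity (n`!%:R^-1 * \sum_(s : 'S_n)
    (-1) ^+ s * t [ffun a => g (s^-1%g a)] : C).
  rewrite (@sum_signs (t g)) ?mulKf// => s.
  by rewrite tA odd_permV.
symmetry; under eq_bigr => f _.
  rewrite tensorZE basis_wedgeE mulrACA mulr_sumr; under eq_bigr => s _ do rewrite mulrCA.
  over.
rewrite -mulr_sumr exchange_big; congr (_ * _).
  by rewrite -invfM -expr2 sqrtCK.
apply: eq_bigr => s _ /=; rewrite -mulr_sumr; congr (_ * _).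
rewrite (bigD1 [ffun a => g (s^-1%g a)])//= big1 ?addr0 => [|f fg].
  rewrite (_ : g == _) ?mulr1//; apply/eqP/ffunP => a.
  by rewrite !ffunE permK.
rewrite (_ : (g == _) = false) ?mulr0//; apply: contraNF fg => /eqP ->.
by apply/eqP/ffunP => a; rewrite !ffunE permKV.
Qed.

(** By [alternating_sum], the infinite spanning family reduces to the finitely many basis wedges, on
    which the sign rule passes to linear combinations. *)
Lemma wedge_space_alternating (t : tensor R M k n) :
  t \in wedge_space R M k n -> alternating t.
Proof.
have /subvP WS : (wedge_space R M k n <= \sum_f <[basis_wedge f]>)%VS.
  apply: setspan_sub => _ [psi ->].
  rewrite [wedge psi]alternating_sum; last exact: wedge_perm.
  by apply: memv_sumr => f _; apply: memvZ; exact: memv_line.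
move=> /WS/memv_sumP[v vl ->] f s; rewrite !sum_ffunE mulr_sumr.
apply: eq_bigr => g _; have /vlineP[x ->] := vl g isT.
by rewrite !(tensorZE x) wedge_perm mulrCA.
Qed.

End WedgeTrace.

(** * Trace and diagonal matrix elements of the exterior power *)

Section WedgeOperator.
Variables (R : realType) (M k : nat) (K : 'End(LIM R M k)).

Definition entry (p q : 'I_M * 'I_k) : R[i] := kblock K p.1 q.1 p.2 q.2.

Lemma wedge_op_basis_coord n (f : {ffun 'I_n -> 'I_M * 'I_k}) :
  tensor_op K n (basis_wedge R f) f =
  (sqrtC n`!%:R)^-1 * \det (\matrix_(a, b) entry (f a) (f b)) :> R[i].
Proof.
rewrite tensor_op_wedge wedgeE; congr (_ * \det _).
by apply/matrixP => a b; rewrite mxE [RHS]mxE /entry mxE Lip_basis.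
Qed.

Lemma lftrace_wedge_op n :
  lftrace (wedge_op K n) = n`!%:R^-1 *
    \sum_(f : {ffun 'I_n -> 'I_M * 'I_k}) \det (\matrix_(a, b) entry (f a) (f b)).
Proof.
pose b (f : {ffun 'I_n -> 'I_M * 'I_k}) : wedge_pow R M k n :=
  Subvs (wedge_mem (fun a => Lbasis R (f a).1 (f a).2)).
have clin (f : {ffun 'I_n -> 'I_M * 'I_k}) : scalar
    (fun u : wedge_pow R M k n => (sqrtC n`!%:R)^-1 * vsval u f : R[i]).
  by move=> x u v; rewrite linearP !ffunE mulrDr mulrCA.
(* These are the coefficients of [alternating_sum]; their factor 1/sqrt(n!) joins the one of the
   diagonal coordinate to give 1/n!. *)
pose c f : {scalar wedge_pow R M k n} := HB.pack
  (fun u : wedge_pow R M k n => (sqrtC n`!%:R)^-1 * vsval u f : R[i])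
  (GRing.isLinear.Build _ _ _ _ _ (clin f)).
rewrite (@lftrace_frame _ _ _ b c) => [|u].
  rewrite mulr_sumr; apply: eq_bigr => f _.
  rewrite /c /= wedge_opE (wedge_op_basis_coord f) mulrA -invfM -expr2.
  by rewrite sqrtCK.
apply: val_inj; rewrite /= linear_sum.
rewrite [LHS](alternating_sum (wedge_space_alternating (subvsP u))).
by apply: eq_bigr => f _; rewrite [RHS]linearZ.
Qed.

(** The sqrt(n!) from the inner product cancels the normalization of the wedge, so the minor appears
    without a factor. *)
Lemma tip_wedge_op_basis n (f : {ffun 'I_n -> 'I_M * 'I_k}) :
  tip (basis_wedge R f) (tensor_op K n (basis_wedge R f)) =
  \det (\matrix_(a, b) entry (f a) (f b)).
Proof.
rewrite {2}/basis_wedge tensor_op_wedge tip_basis_wedge; last exact: wedge_perm.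
rewrite -tensor_op_wedge.
rewrite wedge_op_basis_coord mulVKf// sqrtC_eq0 pnatr_eq0 -lt0n fact_gt0//.
Qed.

End WedgeOperator.

(** * From the flattened block matrix to double indices *)

Lemma sum_det_Kmx (R : realType) (M k n : nat) (K : 'End(LIM R M k)) :
  \sum_(f : {ffun 'I_n -> 'I_(\sum_(i < M) k)})
     \det (\matrix_(a, b) Kmx K (f a) (f b)) =
  \sum_(f : {ffun 'I_n -> 'I_M * 'I_k}) \det (\matrix_(a, b) entry K (f a) (f b)).
Proof.
(* [r] and [r'] are the inverse bijections between pairs (block, position in block) and row numbers
   of [Kmx K]. *)
pose r (p : 'I_M * 'I_k) : 'I_(\sum_(i < M) k) := tagnat.Rank p.1 p.2.
pose r' (i : 'I_(\sum_(i < M) k)) : 'I_M * 'I_k :=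
  (tagnat.sig1 i, tagnat.sig2 i).
have rK : cancel r r'.
  move=> [m j]; congr (_, _); first exact: tagnat.Rank1K.
  by rewrite /= tagnat.Rank2K; apply: val_inj.
have rE p q : Kmx K (r p) (r q) = entry K p q.
  by rewrite /entry -[in RHS](mxblockK (kblock K)) [RHS]mxE.
have r'K : cancel r' r by move=> i; exact: tagnat.sig2K.
rewrite (reindex (fun f : {ffun 'I_n -> 'I_M * 'I_k} => [ffun a => r (f a)])).
  apply: eq_bigr => f _; congr (\det _); apply/matrixP => a b.
  by rewrite mxE [RHS]mxE !ffunE rE.
exists (fun g : {ffun 'I_n -> 'I_(\sum_(i < M) k)} => [ffun a => r' (g a)]).
  by move=> f _; apply/ffunP => a; rewrite !ffunE rK.
by move=> g _; apply/ffunP => a; rewrite !ffunE r'K.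
Qed.

Lemma big_ffun_pair (V : nmodType) (I T U : finType)
    (F : {ffun I -> T * U} -> V) :
  \sum_(f : {ffun I -> T * U}) F f =
  \sum_(j : {ffun I -> U}) \sum_(m : {ffun I -> T}) F [ffun a => (m a, j a)].
Proof.
rewrite pair_bigA /= (reindex (fun p : {ffun I -> U} * {ffun I -> T} =>
  [ffun a => (p.2 a, p.1 a)]))//.
exists (fun f : {ffun I -> T * U} => ([ffun a => (f a).2], [ffun a => (f a).1])).
  by move=> [j m] _; congr (_, _); apply/ffunP => a; rewrite !ffunE.
by move=> f _; apply/ffunP => a; rewrite !ffunE; case: (f a).
Qed.

(** * Convergence of the series and the final formulas *)

Local Open Scope classical_set_scope.

Lemma cvg_series_eventually_cst (F : numFieldType) (u : nat -> F^o) (N : nat) (l : F) :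
  (forall n, (N < n)%N -> \sum_(i < n) u i = l) -> series u @ \oo --> (l : F^o).
Proof.
(* [series u n] sums the indices below [n], so the index [N] is included from [N.+1] on. *)
move=> ul; apply: cvg_near_cst; exists N.+1 => // n /= Nn.
by rewrite /series /= big_mkord ul.
Qed.

Theorem theorem4p1 (R : realType) (M k : nat) (hM : (0 < M)%N)
    (hk : (0 < k)%N) (K : 'End(LIM R M k)) :
  (forall n : nat,
     lftrace (wedge_op K n) =
     n`!%:R^-1 *
     \sum_(j : {ffun 'I_n -> 'I_k}) \sum_(m : {ffun 'I_n -> 'I_M})
       wip (Phi R m j) (wedge_op K n (Phi R m j))) /\
  (forall z : R[i],
     [/\ cvgn (series (det1_term K z)),
         fredholm_det1 K z = \det (1%:M + z *: Kmx K) &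
         series (fun n : nat => z ^+ n / n`!%:R *
           (\sum_(j : {ffun 'I_n -> 'I_k}) \sum_(m : {ffun 'I_n -> 'I_M})
             \det (\matrix_(a < n, b < n)
                     kblock K (m a) (m b) (j a) (j b))) : R[i]^o) @ \oo
           --> (\det (1%:M + z *: Kmx K) : R[i]^o)]).
Proof.
have entry_pair n (m : {ffun 'I_n -> 'I_M}) (j : {ffun 'I_n -> 'I_k}) :
    \matrix_(a, b) entry K ([ffun a => (m a, j a)] a) ([ffun a => (m a, j a)] b) =
    \matrix_(a < n, b < n) kblock K (m a) (m b) (j a) (j b).
  by apply/matrixP => a b; rewrite mxE [RHS]mxE /entry !ffunE.
split=> [n|z].
  rewrite lftrace_wedge_op big_ffun_pair; congr (_ * _).
  apply: eq_bigr => j _; apply: eq_bigr => m _.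
  rewrite -tip_wedge_op_basis /wip wedge_opE /= /basis_wedge.
  by under eq_fun => a do rewrite ffunE.
(* Both series of the statement turn out to have the terms [u], so a single limit settles them. *)
pose u (n : nat) : R[i]^o := z ^+ n / n`!%:R *
  \sum_(f : {ffun 'I_n -> 'I_(\sum_(i < M) k)})
     \det (\matrix_(a, b) Kmx K (f a) (f b)).
have u_lim : series u @ \oo --> (\det (1%:M + z *: Kmx K) : R[i]^o).
  exact: (cvg_series_eventually_cst (@det_1D_sum_index _ _ (Kmx K) z)).
rewrite /fredholm_det1; have -> : det1_term K z = u.
  apply: funext => n; rewrite /det1_term lftrace_wedge_op mulrA.
  by rewrite -sum_det_Kmx.
have -> : (fun n : nat => z ^+ n / n`!%:R *
     (\sum_(j : {ffun 'I_n -> 'I_k}) \sum_(m : {ffun 'I_n -> 'I_M})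
       \det (\matrix_(a < n, b < n)
               kblock K (m a) (m b) (j a) (j b))) : R[i]^o) = u.
  apply: funext => n; rewrite /u sum_det_Kmx big_ffun_pair; congr (_ * _).
  by apply: eq_bigr => j _; apply: eq_bigr => m _; rewrite entry_pair.
split; [exact: cvgP u_lim | | exact: u_lim].
by apply: cvg_lim u_lim; exact: norm_hausdorff.
Qed.
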